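(* Let $(x^*,u^* )$ be a local solution of the problem (P) and let $y^*$ be its KKT multiplier, i.e. $(x^*,u^*,y^* )$ is a KKT point of (P). Then $$d^\top\nabla^2 f(x^* )\,d\ge 0\qquad\text{for all } d\in\mathcal C^*.$$
   Context: $[m]=\{1,\dots,m\}$; for $T\subseteq[m]$, $A_T$ is the submatrix of $A$ formed by the rows indexed by $T$. $f:\mathbb{R}^n\to\mathbb{R}$ is twice continuously differentiable, $\lambda>0$, $A\in\mathbb{R}^{m\times n}$, $b\in\mathbb{R}^m$, and $h(u):=\|u_+\|_0$ is the number of strictly positive entries of $u\in\mathbb{R}^m$. Problem (P): $\min_{x\in\mathbb{R}^n,u\in\mathbb{R}^m} f(x)+\lambda h(u)$ subject to $Ax+b=u$. KKT point of (P): a triple $(x,u,y)$ with $\nabla f(x)+A^\top y=0$, $y\in\lambda\,\partial h(u)$, $Ax+b-u=0$, where $\partial h$ is the limiting subdifferential, given by $\partial h(u)=\{v\in\mathbb{R}^m : v_i\ge 0 \text{ if } u_i=0,\ v_i=0 \text{ if } u_i\ne 0\}$. Index sets at $(x^*,u^*,y^* )$: $\mathcal I_0^*:=\{i\in[m]: u_i^*=0,\ y_i^*=0\}$ and $\mathcal I_+^*:=\{i\in[m]: u_i^*=0,\ y_i^*>0\}$. Cone: $\mathcal C^*:=\{d\in\mathbb{R}^n : A_{\mathcal I_+^*}d=0,\ A_{\mathcal I_0^*}d\le 0\}$. *)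

(* Defs.v *)
From HB Require Import structures.
From mathcomp Require Import all_boot all_order all_algebra.
From mathcomp Require Import all_classical all_reals all_analysis.
From mathcomp Require Import lra.

Set Implicit Arguments.
Unset Strict Implicit.
Unset Printing Implicit Defensive.

Import Order.TTheory GRing.Theory Num.Theory.
Import numFieldNormedType.Exports.

Local Open Scope classical_set_scope.
Local Open Scope ring_scope.

(* Vectors of R^n are columns 'cV[R]_n. The norm that the library puts on
   matrices is the maximum norm; differentiability, limits, local minimality
   and regular subgradients depend on the norm only up to equivalence, so
   nothing changes with respect to the Euclidean norm. *)

Section smooth_functions.
Context {R : realType} {n : nat}.
Implicit Types (f : 'cV[R]_n -> R) (x : 'cV[R]_n).

Definition grad f x : 'cV[R]_n := \col_i 'D_(delta_mx i 0) f x.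

Definition hess f x : 'M[R]_n :=
  \matrix_(i, j) 'D_(delta_mx j 0) (fun z => grad f z i 0) x.

Definition twice_continuously_differentiable f : Prop :=
  [/\ forall x, differentiable f x,
      forall x, differentiable (grad f) x &
      continuous (hess f)].

End smooth_functions.

Section subdifferentials.
Context {R : realType} {m : nat}.
Implicit Types (g : 'cV[R]_m -> R) (u v w : 'cV[R]_m).

Definition dotp u v : R := \sum_i u i 0 * v i 0.

(* liminf_(w -> u, w != u) (g w - g u - <v, w - u>) / |w - u| >= 0, cleared of
   denominators. *)
Definition regular_subdiff g u : set 'cV[R]_m :=
  [set v | forall e : R, 0 < e ->
     \forall w \near u, g u + dotp v (w - u) - e * `|w - u| <= g w].

Definition limiting_subdiff g u : set 'cV[R]_m :=
  [set v | exists (w_ v_ : nat -> 'cV[R]_m),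
     [/\ w_ @ \oo --> u,
         (fun k => g (w_ k)) @ \oo --> g u,
         forall k, regular_subdiff g (w_ k) (v_ k) &
         v_ @ \oo --> v]].

Definition npos u : R := #|[pred i | 0 < u i 0]|%:R.

End subdifferentials.

Section limiting_subdiff_npos.
Context {R : realType} {m : nat}.
Implicit Types (u v w : 'cV[R]_m).

Let e_ (i : 'I_m) : 'cV[R]_m := delta_mx i 0.

Let norm_e i (t : R) : `|t *: e_ i| <= `|t|.
Proof.
rewrite normrZ -[leRHS]mulr1 ler_wpM2l//.
rewrite [leLHS]mx_normrE; apply: bigmax_le => // -[j k] _ /=.
by rewrite mxE; case: (_ && _); rewrite ?normr1 ?normr0.
Qed.

Let dotp_e i (t : R) v : dotp v (t *: e_ i) = t * v i 0.
Proof.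
rewrite /dotp (bigD1 i)//= big1 ?addr0.
  by rewrite !mxE !eqxx mulr1 mulrC.
by move=> j /negbTE ji; rewrite !mxE ji mulr0 mulr0.
Qed.

Let nposE u : npos u = \sum_i (0 < u i 0)%R%:R.
Proof.
rewrite /npos -sum1_card natr_sum big_mkcond; apply: eq_bigr => i _.
by rewrite inE; case: (0 < _).
Qed.

Let coord_near u (e : R) : 0 < e -> \forall w \near u, forall i, `|(w : 'cV[R]_m) i 0 - u i 0| < e.
Proof.
move=> e0; near=> w => i.
apply: (@le_lt_trans _ _ `|w - u|); last first.
  by near: w; apply: cvgr_distC_lt => //; exact: cvg_id.
rewrite [leRHS]mx_normrE.
have := @le_bigmax _ _ ('I_m * 'I_1)%type 0 (fun k => `|(w - u) k.1 k.2|) (i, 0).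
by rewrite /= !mxE.
Unshelve. all: by end_near. Qed.

Let reg_dir u v i (s : R) : regular_subdiff npos u v ->
  (exists2 t0 : R, 0 < t0 & forall t, 0 < t < t0 -> npos (u + (t * s) *: e_ i) <= npos u) ->
  s * v i 0 <= 0.
Proof.
move=> uv [t0 t00 H]; apply/ler_addgt0Pl => e e0; rewrite addr0.
have se : 0 < e / (`|s| + 1) by rewrite divr_gt0// ltr_pwDr.
have /nbhs_ballP[r /= r0 B] := uv _ se.
pose t := Num.min (t0 / 2) (r / (2 * (`|s| + 1))).
have s1 : 0 < `|s| + 1 by rewrite ltr_pwDr.
have tp : 0 < t by rewrite lt_min !divr_gt0// mulr_gt0.
have tt0 : t < t0 by rewrite gt_min ltr_pdivrMr// ltr_pMr// ltr1n.
have trs : t * (`|s| + 1) <= r / 2.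
  rewrite -ler_pdivlMr// ge_min; apply/orP; right.
  by rewrite invfM mulrA.
have /= := B (u + (t * s) *: e_ i).
have nle : `|(t * s) *: e_ i| <= t * `|s|.
  by apply: le_trans (norm_e _ _) _; rewrite normrM gtr0_norm.
have ub : ball u r (u + (t * s) *: e_ i).
  rewrite -ball_normE /= opprD addrA subrr add0r normrN.
  apply: le_lt_trans nle _; apply: (@le_lt_trans _ _ (t * (`|s| + 1))).
    by rewrite ler_pM2l// lerDl.
  by apply: le_lt_trans trs _; rewrite ltr_pdivrMr// ltr_pMr// ltr1n.
have -> : u + (t * s) *: e_ i - u = (t * s) *: e_ i by rewrite addrAC subrr add0r.
move=> /(_ ub); rewrite dotp_e => h1.
have h2 := H t; rewrite tp tt0 /= in h2; have {}h2 := h2 isT.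
have h3 : e / (`|s| + 1) * `|(t * s) *: e_ i| <= t * e.
  apply: (@le_trans _ _ (e / (`|s| + 1) * (t * (`|s| + 1)))).
    rewrite ler_pM2l//; apply: le_trans nle _; by rewrite ler_pM2l// lerDl.
  by rewrite mulrCA divfK ?gt_eqF.
have h4 : t * (s * v i 0) <= t * e by rewrite mulrA; lra.
by move: h4; rewrite ler_pM2l.
Qed.

Lemma regular_subdiff_nposP u v : regular_subdiff npos u v <->
  forall i, (u i 0 = 0 -> 0 <= v i 0) /\ (u i 0 != 0 -> v i 0 = 0).
Proof.
have addE i s k : (u + s *: e_ i) k 0 = u k 0 + s *+ (k == i).
  by rewrite !mxE eqxx andbT mulr_natr.
split.
  move=> uv i; split => [ui|ui].
    rewrite -oppr_le0 -mulN1r; apply: (reg_dir uv); exists 1 => // t /andP[t0 _].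
    rewrite !nposE; apply: ler_sum => k _; rewrite ler_nat addE.
    case: eqVneq => [->|_]; rewrite ?addr0// ui add0r mulr1n mulrN1 oppr_gt0.
    by rewrite (lt_gtF t0).
  have K s : `|s| = 1 -> s * v i 0 <= 0.
    move=> s1; apply: (reg_dir uv); exists `|u i 0|; first by rewrite normr_gt0.
    move=> t /andP[t0 tu].
    rewrite !nposE; apply: ler_sum => k _; rewrite ler_nat addE.
    case: eqVneq => [->|_]; rewrite ?addr0// mulr1n.
    have: `|t * s| < `|u i 0| by rewrite normrM s1 mulr1 gtr0_norm.
    case: (ltP 0 (u i 0)) => u0; first by case: (0 < _).
    rewrite (ler0_norm u0) ltr_norml opprK => /andP[_ hh].
    by rewrite ltNge (_ : _ <= 0)//; lra.
  have := K 1; have := K (-1); rewrite normrN normr1 mul1r mulN1r.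
  by move=> /(_ erefl) a /(_ erefl) b; apply/eqP; rewrite eq_le b/= -oppr_le0.
move=> H e e0.
have [d d0 Hd] : exists2 d : R, 0 < d & forall i, (u i 0 != 0 -> d <= `|u i 0|) /\ d * v i 0 <= 1.
  exists (\big[Num.min/1]_i Num.min (if u i 0 == 0 then 1 else `|u i 0|) (`|v i 0| + 1)^-1).
    apply: lt_bigmin => // i _; rewrite lt_min invr_gt0 ltr_pwDr// andbT.
    by case: eqP => // /eqP; rewrite normr_gt0.
  move=> i; set d := \big[_/_]_i0 _.
  have : d <= Num.min (if u i 0 == 0 then 1 else `|u i 0|) (`|v i 0| + 1)^-1.
    exact: (bigmin_le _ i).
  rewrite le_min => /andP[d1 d2]; split; first by move=> /negbTE ui; rewrite ui in d1.
  apply: (@le_trans _ _ (d * (`|v i 0| + 1))).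
    rewrite ler_wpM2l//; last by apply: le_trans (ler_norm _) _; rewrite lerDl.
    apply: le_bigmin => // j _; rewrite le_min invr_ge0 addr_ge0// andbT.
    by case: ifP.
  by rewrite -ler_pdivlMr ?ltr_pwDr// mul1r.
near=> w.
have wu : forall i, `|w i 0 - u i 0| < d by near: w; exact: coord_near.
suff : npos u + dotp v (w - u) <= npos w.
  have : 0 <= e * `|w - u| by rewrite mulr_ge0// ltW.
  by lra.
rewrite !nposE /dotp -big_split/=; apply: ler_sum => i _; rewrite !mxE.
have [h1 h2] := H i; have [h3 h4] := Hd i.
have := wu i; rewrite ltr_norml => /andP[w1 w2].
have [ui|ui] := eqVneq (u i 0) 0.
  have v0 := h1 ui; rewrite ui ltxx/= add0r subr0.
  rewrite ui subr0 in w1 w2.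
  case: ltP => wi /=; last by rewrite mulr_ge0_le0.
  by apply: le_trans h4; rewrite mulrC ler_wpM2r// ltW.
rewrite (h2 ui) mul0r addr0 ler_nat.
have := h3 ui; case: (ltP 0 (u i 0)) => // u0.
rewrite gtr0_norm// => du; suff -> : 0 < w i 0 by [].
by lra.
Unshelve. all: by end_near. Qed.

Lemma limiting_subdiff_nposP u v : limiting_subdiff npos u v <->
  forall i, (u i 0 = 0 -> 0 <= v i 0) /\ (u i 0 != 0 -> v i 0 = 0).
Proof.
split; last first.
  move=> /regular_subdiff_nposP uv.
  by exists (fun=> u), (fun=> v); split => //; exact: cvg_cst.
move=> [w_ [v_ [wu _ reg vv]]] i.
have R1 k := (regular_subdiff_nposP _ _).1 (reg k) i.
have vi : (fun k => v_ k i 0) @ \oo --> v i 0.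
  exact: (cvg_comp _ _ vv (@coord_continuous _ m 1 i 0 v)).
have wi : (fun k => w_ k i 0) @ \oo --> u i 0.
  exact: (cvg_comp _ _ wu (@coord_continuous _ m 1 i 0 u)).
have vl := cvg_lim (@Rhausdorff R) vi; split => ui.
  rewrite -vl; apply: limr_ge; first by apply/cvg_ex; exists (v i 0).
  near=> k; have [Wk|Wk] := eqVneq (w_ k i 0) 0; first exact: (R1 k).1.
  by rewrite (R1 k).2.
rewrite -vl; apply: lim_near_cst; first exact: Rhausdorff.
near=> k; apply: (R1 k).2; near: k; exact: (cvgr_neq0 _ wi ui).
Unshelve. all: by end_near. Qed.
End limiting_subdiff_npos.

Section problem.
Context {R : realType} {m n : nat}.
Variables (f : 'cV[R]_n -> R) (lam : R) (A : 'M[R]_(m, n)) (b : 'cV[R]_m).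
Implicit Types (x d : 'cV[R]_n) (u y : 'cV[R]_m).

Definition feasible (p : 'cV[R]_n * 'cV[R]_m) : Prop := A *m p.1 + b = p.2.

Definition objective (p : 'cV[R]_n * 'cV[R]_m) : R := f p.1 + lam * npos p.2.

Definition local_solution x u : Prop :=
  feasible (x, u) /\
  \forall p \near (x, u), feasible p -> objective (x, u) <= objective p.

Definition KKT_point x u y : Prop :=
  [/\ grad f x + A^T *m y = 0,
      [set lam *: v | v in limiting_subdiff npos u] y &
      A *m x + b - u = 0].

Definition index_zero u y : {set 'I_m} :=
  [set i | (u i 0 == 0) && (y i 0 == 0)]%SET.

Definition index_pos u y : {set 'I_m} :=
  [set i | (u i 0 == 0) && (0 < y i 0)]%SET.

Definition rows_of (T : {set 'I_m}) : 'M[R]_(#|T|, n) :=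
  rowsub (fun k : 'I_#|T| => enum_val k) A.

Definition critical_cone u y : set 'cV[R]_n :=
  [set d | rows_of (index_pos u y) *m d = 0 /\
           forall k, (rows_of (index_zero u y) *m d) k 0 <= 0].

End problem.

(* Main.v *)
(* Move from the solution along the ray t |-> (xs + t d, us + t A d), t > 0.
   A component of us that vanishes does not increase along the ray, since d is
   critical, and the sign of a nonzero component is preserved for small t; so
   the number of positive entries does not increase, and local optimality gives
   f xs <= f (xs + t d) for small t > 0. By complementarity of ys and A d, the
   slope of f along d at xs is - ys^T A d = 0; hence the second derivative of
   f along d at xs is nonnegative. *)
Require Import Defs.
From HB Require Import structures.
From mathcomp Require Import all_boot all_order all_algebra.
From mathcomp Require Import all_classical all_reals all_analysis.
Import Order.TTheory GRing.Theory Num.Theory.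
Import numFieldNormedType.Exports.
Local Open Scope classical_set_scope.
Local Open Scope ring_scope.

Lemma derive_coordE (R : realType) (n : nat) (g : 'cV[R]_n -> R)
    (x d : 'cV[R]_n) :
  differentiable g x ->
  'D_d g x = \sum_i d i 0 * 'D_(delta_mx i 0) g x.
Proof.
move=> gx; rewrite deriveE// [d in LHS]matrix_sum_delta linear_sum.
apply: eq_bigr => i _.
by rewrite big_ord1 linearZ/= deriveE.
Qed.

(** For every increment [h], the difference quotient of the restriction to the line at [t] is that
    of [g] at [x + t *: d] along [d]. *)
Lemma is_derive_line (R : realType) (n : nat) (g : 'cV[R]_n -> R)
    (x d : 'cV[R]_n) (t : R) :
  differentiable g (x + t *: d) ->
  is_derive t 1 (fun s => g (x + s *: d)) ('D_d g (x + t *: d)).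
Proof.
move=> /(@diff_derivable _ _ _ _ _ d) gx.
have E : (fun h : R => h^-1 *: (((fun s => g (x + s *: d)) \o shift t) (h *: 1)
            - g (x + t *: d))) =
         (fun h : R => h^-1 *: ((g \o shift (x + t *: d)) (h *: d)
            - g (x + t *: d))).
  apply/funext => h /=; congr (_ *: (g _ - _)).
  by rewrite scalerDl addrCA -[h *: 1]/(h * 1) mulr1.
by apply: DeriveDef; rewrite /derivable/derive E.
Qed.

(** For differentiable [f] the sum is the slope of [f] along the line, so this computes the second
    derivative of [f] along [d]. *)
Lemma is_derive_grad_line (R : realType) (n : nat) (f : 'cV[R]_n -> R)
    (x d : 'cV[R]_n) :
  differentiable (grad f) x ->
  is_derive (0 : R) 1 (fun s => \sum_i d i 0 * grad f (x + s *: d) i 0)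
    ((d^T *m hess f x *m d) 0 0).
Proof.
move=> gx.
have gi i : differentiable (fun z => grad f z i 0) x.
  apply: (@differentiable_comp _ _ _ _ (grad f) (fun M : 'cV[R]_n => M i 0)) => //.
  exact: differentiable_coord.
have di i : is_derive (0 : R) 1 (fun s => grad f (x + s *: d) i 0)
    (\sum_j d j 0 * hess f x i j).
  have x0 : x + 0 *: d = x by rewrite scale0r addr0.
  have := @is_derive_line _ _ (fun z => grad f z i 0) x d 0.
  rewrite x0 => /(_ (gi i)); rewrite derive_coordE//.
  by under [X in _ -> is_derive _ _ _ X]eq_bigr do rewrite mxE.
have -> : (d^T *m hess f x *m d) 0 0 =
    \sum_i d i 0 *: \sum_j d j 0 * hess f x i j.
  rewrite -mulmxA mxE; apply: eq_bigr => i _; rewrite !mxE; congr (_ * _).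
  by apply: eq_bigr => j _; rewrite mulrC.
have -> : (fun s => \sum_i d i 0 * grad f (x + s *: d) i 0) =
    \sum_i (d i 0 \*: (fun s => grad f (x + s *: d) i 0)).
  by apply/funext => s; rewrite fct_sumE.
by apply: is_derive_sum => i; exact: is_deriveZ.
Qed.

(** If [q < 0], then [dphi] is negative just to the right of [0], and the mean value theorem makes
    [phi] drop below [phi 0] there. Minimality is one-sided because the cone may contain [d] without
    [- d]. *)
Lemma second_derivative_ge0 (R : realType) (phi dphi : R -> R) (q : R) :
  (forall t : R, is_derive t 1 phi (dphi t)) -> dphi 0 = 0 ->
  is_derive (0 : R) 1 dphi q ->
  (\forall t \near 0^'+, phi 0 <= phi t) -> 0 <= q.
Proof.
move=> Dphi dphi0 [cq Dq] phi_min; rewrite leNgt; apply/negP => q0.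
have dphi_lt0 : \forall t \near 0^'+, dphi t < 0.
  have /cvg_dnbhs_at_right cq0 : h^-1 *: ((dphi \o shift 0) (h *: 1) - dphi 0)
      @[h --> 0^'] --> q by rewrite -Dq.
  near=> t; have t0 : 0 < t by [].
  have : t^-1 *: ((dphi \o shift 0) (t *: 1) - dphi 0) < 0.
    by near: t; exact: (cvgr_lt _ cq0).
  (* As [dphi 0 = 0], the quotient is [dphi t / t], which for [t > 0] has the sign of [dphi t]. *)
  rewrite /= addr0 dphi0 subr0 -[t *: 1]/(t * 1) mulr1 -[_ *: _]/(_ * _).
  by rewrite pmulr_rlt0// invr_gt0.
have [e /= e0 dphi_e] : exists2 e : R, 0 < e &
    forall t, 0 < t < e -> dphi t < 0.
  have [e /= e0 H] := dphi_lt0; exists e => // t /andP[t0 te].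
  by apply: H => //=; rewrite sub0r normrN gtr0_norm.
have [t [t0 te pt]] : exists t, [/\ 0 < t, t < e & phi 0 <= phi t].
  have [r /= r0 H] := phi_min; pose t := Num.min (e / 2) (r / 2).
  have tgt0 : 0 < t by rewrite lt_min !divr_gt0.
  exists t; split => //; first by rewrite gt_min ltr_pdivrMr// ltr_pMr// ltr1n.
  apply: H => //=; rewrite sub0r normrN gtr0_norm// gt_min.
  by apply/orP; right; rewrite ltr_pdivrMr// ltr_pMr// ltr1n.
have [|c] := MVT t0 (fun s _ => Dphi s).
  apply: continuous_subspaceT => s; apply/differentiable_continuous.
  by apply/derivable1_diffP; have [] := Dphi s.
(* Here [phi t - phi 0 = dphi c * t] with [0 < c < t < e]: the left side is nonnegative, the right
   side negative. *)
rewrite in_itv/= => /andP[c0 ct] /eqP; rewrite subr0; apply/negP.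
rewrite gt_eqF// (@lt_le_trans _ _ 0) ?subr_ge0//.
by rewrite pmulr_llt0// dphi_e// c0 (lt_trans ct).
Unshelve. all: by end_near. Qed.

(** The set of positive entries can only shrink: negative entries stay negative by continuity, zero
    entries become [t * v i 0 <= 0], and finitely many entries share one neighbourhood. *)
Lemma near_npos_le (R : realType) (m : nat) (u v : 'cV[R]_m) :
  (forall i, u i 0 = 0 -> v i 0 <= 0) ->
  \forall t \near 0^'+, npos (u + t *: v) <= npos u.
Proof.
move=> uv.
have pos_le i : \forall t \near 0^'+, 0 < (u + t *: v) i 0 -> 0 < u i 0.
  case: (ltgtP (u i 0) 0) => [ui|ui|ui].
  - have c : (fun t : R => u i 0 + t * v i 0) @ 0^'+ --> u i 0 + 0 * v i 0.
      apply: cvg_at_right_filter; apply: cvgD; first exact: cvg_cst.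
      by apply: cvgM; [exact: cvg_id|exact: cvg_cst].
    rewrite mul0r addr0 in c.
    near=> t; rewrite !mxE => H; exfalso; move: H; apply/negP; rewrite -leNgt.
    by apply/ltW; near: t; exact: (cvgr_lt _ c).
  - by near=> t.
  - near=> t; rewrite !mxE ui add0r => H; exfalso; move: H; apply/negP.
    by rewrite -leNgt; apply: mulr_ge0_le0 => //; exact: uv.
near=> t; rewrite /npos ler_nat; apply/subset_leq_card/fintype.subsetP => i.
rewrite !inE; move: i; near: t.
exact: filter_forall.
Unshelve. all: by end_near. Qed.

Theorem theorem5 (R : realType) (m n : nat) (f : 'cV[R]_n -> R) (lam : R)
    (A : 'M[R]_(m, n)) (b : 'cV[R]_m)
    (xs : 'cV[R]_n) (us ys : 'cV[R]_m) :
  twice_continuously_differentiable f ->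
  0 < lam ->
  local_solution f lam A b xs us ->
  KKT_point f lam A b xs us ys ->
  forall d : 'cV[R]_n, critical_cone A us ys d ->
    0 <= (d^T *m hess f xs *m d) 0 0.
Proof.
move=> [df dgf _] lam0 [/= feas locmin] [/eqP]; rewrite addr_eq0 => /eqP gradE.
move=> [w /limiting_subdiff_nposP wP wE] _ d [dpos dzero].
have Ad_pos i : us i 0 = 0 -> 0 < ys i 0 -> (A *m d) i 0 = 0.
  move=> ui yi; have iI : i \in index_pos us ys by rewrite inE ui eqxx.
  have /matrixP/(_ (enum_rank_in iI i) 0) := dpos.
  by rewrite /rows_of mul_rowsub_mx mxE [RHS]mxE enum_rankK_in.
have Ad_zero i : us i 0 = 0 -> ys i 0 = 0 -> (A *m d) i 0 <= 0.
  move=> ui yi; have iI : i \in index_zero us ys by rewrite inE ui yi eqxx.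
  have := dzero (enum_rank_in iI i).
  by rewrite /rows_of mul_rowsub_mx mxE enum_rankK_in.
(* [ys] is [lam] times a limiting subgradient [w], so the two index sets together cover all zero
   entries of [us]. *)
have y_pos i : us i 0 = 0 -> ys i 0 = 0 \/ 0 < ys i 0.
  move=> ui; have : 0 <= ys i 0.
    by rewrite -wE mxE; apply: mulr_ge0; [exact: ltW|exact: (wP i).1].
  by rewrite le_eqVlt => /orP[/eqP<-|]; [left|right].
have y_Ad i : ys i 0 * (A *m d) i 0 = 0.
  have [ui|ui] := eqVneq (us i 0) 0.
    by have [->|yi] := y_pos i ui; [rewrite mul0r|rewrite Ad_pos// mulr0].
  by rewrite -wE mxE (wP i).2// mulr0 mul0r.
have Ad_le0 i : us i 0 = 0 -> (A *m d) i 0 <= 0.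
  by move=> ui; have [/Ad_zero->//|yi] := y_pos i ui; rewrite Ad_pos.
(* The slope [dphi] stays open until [is_derive_line] fixes it as ['D_d f (xs + t *: d)]. *)
apply: (@second_derivative_ge0 _ (fun s => f (xs + s *: d))); last 1 first.
- have cvg_path : (xs + t *: d, us + t *: (A *m d)) @[t --> 0^'+] --> (xs, us).
    have H k (z e : 'cV[R]_k) : z + t *: e @[t --> 0^'+] --> z.
      rewrite -[X in _ --> X]addr0 -(scale0r e); apply: cvg_at_right_filter.
      by apply: cvgD; [exact: cvg_cst|apply: cvgZr_tmp; exact: cvg_id].
    by exact: (cvg_pair (H _ xs d) (H _ us (A *m d))).
  have path_min : \forall t \near 0^'+,
      feasible A b (xs + t *: d, us + t *: (A *m d)) ->
      objective f lam (xs, us) <=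
        objective f lam (xs + t *: d, us + t *: (A *m d)).
    exact: cvg_path _ locmin.
  near=> t.
  have path_feas : feasible A b (xs + t *: d, us + t *: (A *m d)).
    by rewrite /feasible/= mulmxDr -scalemxAr addrAC feas.
  have npos_le : npos (us + t *: (A *m d)) <= npos us.
    by near: t; exact: near_npos_le.
  have obj_le : objective f lam (xs, us) <=
      objective f lam (xs + t *: d, us + t *: (A *m d)).
    by move: path_feas; near: t.
  rewrite scale0r addr0 -(lerD2r (lam * npos us)).
  by apply: (le_trans obj_le); rewrite /objective/= lerD2l ler_pM2l.
- by move=> t; exact: is_derive_line.
- rewrite /= derive_coordE// scale0r addr0.
  transitivity ((d^T *m grad f xs) 0 0).
    by rewrite mxE; apply: eq_bigr => i _; rewrite !mxE.
  (* Stationarity turns the slope into [- (A *m d)^T *m ys], whose terms vanish by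
     complementarity. *)
  rewrite gradE mulmxN mulmxA -trmx_mul !mxE big1 ?oppr0// => i _.
  by rewrite mxE mulrC y_Ad.
- have -> : (fun t => 'D_d f (xs + t *: d)) =
      (fun s => \sum_i d i 0 * grad f (xs + s *: d) i 0).
    apply/funext => t; rewrite derive_coordE//.
    by apply: eq_bigr => i _; rewrite mxE.
  exact: is_derive_grad_line.
Unshelve. all: by end_near. Qed.
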